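(* Let $N=2^n$ and let $A\in\mathbb{C}^{N\times N}$ be an invertible normal matrix, $A=VDV^\dagger$ with $V$ unitary and $D$ diagonal. Suppose the eigenvalues of $A$ are accessible through an oracle $O_D$ acting as $O_D|i\rangle|0^l\rangle=|i\rangle|D_{ii}\rangle$ for $i\in\{0,\dots,N-1\}$, where $|D_{ii}\rangle$ is an (exact) $l$-bit representation of $D_{ii}$, and suppose $V$ can be efficiently implemented by a quantum circuit. Let $\alpha_D'\ge 1/\min_i|D_{ii}|$. Then one can construct an $(\alpha_D',m_D',0)$-block-encoding of $A^{-1}$ by a quantum circuit that uses $O_D$, $O_D^\dagger$, $V$ and $V^\dagger$ exactly once each. Moreover $m_D'=\mathcal{O}(l+\mathrm{polylog}(N))$ if $O_D$ uses $\mathcal{O}(l+\mathrm{polylog}(N))$ ancilla qubits.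
   Context: Block-encoding: an $(m+n)$-qubit unitary $U$ is an $(\alpha,m,\epsilon)$-block-encoding of an $n$-qubit operator $M\in\mathbb{C}^{2^n\times 2^n}$ if $\|M-\alpha(\langle 0^m|\otimes I_n)U(|0^m\rangle\otimes I_n)\|\le\epsilon$ in operator norm. Work ancillas used inside the oracle start in and are returned to the all-zero state. Oracle-free unitaries are available as gates; in particular the controlled rotation $|\zeta\rangle|0\rangle\mapsto|\zeta\rangle\bigl(\tfrac{1}{\alpha_D'\zeta}|0\rangle+\sqrt{1-|\tfrac{1}{\alpha_D'\zeta}|^2}\,|1\rangle\bigr)$, where $|\zeta\rangle$ is an $l$-qubit basis state representing the number $\zeta$, is assumed to be implementable exactly. *)

(* Defs.v *)
From mathcomp Require Import all_boot all_order all_algebra.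
From mathcomp Require Import spectral.
From mathcomp Require Import classical_sets reals.
From mathcomp Require Import complex.

Set Implicit Arguments.
Unset Strict Implicit.
Unset Printing Implicit Defensive.

Import Order.TTheory GRing.Theory Num.Theory.
Import ComplexField.Normc.
Local Open Scope ring_scope.
Local Open Scope sesquilinear_scope.
Local Open Scope complex_scope.

(* Computational basis: 'I_(2 ^ w) is identified with bit strings of length w,
   wire 0 carrying the most significant bit, so that concatenation of strings
   is the tensor product of basis states. *)

Definition bits_val (s : seq bool) : nat :=
  foldl (fun acc (b : bool) => (b + acc.*2)%N) 0%N s.

Lemma bits_val_rcons s b : bits_val (rcons s b) = (b + (bits_val s).*2)%N.
Proof. by rewrite /bits_val -cats1 foldl_cat. Qed.

Lemma bits_val_lt s : (bits_val s < 2 ^ size s)%N.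
Proof.
elim/last_ind: s => [//|s b IHs].
rewrite bits_val_rcons size_rcons expnS mul2n.
by case: b; rewrite ?add1n ?add0n ?ltn_Sdouble ?ltn_double.
Qed.

Lemma bits_val_tuple_lt w (x : w.-tuple bool) : (bits_val x < 2 ^ w)%N.
Proof. by rewrite -{2}(size_tuple x) bits_val_lt. Qed.

Definition of_bits w (x : w.-tuple bool) : 'I_(2 ^ w) :=
  Ordinal (bits_val_tuple_lt x).

Definition to_bits w (j : 'I_(2 ^ w)) : w.-tuple bool :=
  [tuple odd (j %/ 2 ^ (w - q.+1)) | q < w].

Lemma of_bitsK w : cancel (@of_bits w) (@to_bits w).
Proof.
move=> x; apply/val_inj/(@eq_from_nth _ false); rewrite !size_tuple // => q ltqw.
rewrite -(tnth_nth false _ (Ordinal ltqw)) tnth_mktuple /=.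
case: x => s /= /eqP <- in q ltqw *.
elim/last_ind: s q ltqw => [//|s b IHs] q; rewrite size_rcons ltnS => leqs.
rewrite nth_rcons bits_val_rcons subSS; have [ltqs|leqs'] := ltnP q (size s).
  rewrite -IHs // -(@prednK (size s - q)) ?subn_gt0 // -subnS expnS.
  by rewrite divnMA divn2 half_bit_double.
have -> : q = size s by apply/eqP; rewrite eqn_leq leqs.
by rewrite subnn divn1 eqxx oddD odd_double addbF oddb.
Qed.

Lemma to_bitsK w : cancel (@to_bits w) (@of_bits w).
Proof.
have inj : injective (@of_bits w) := can_inj (@of_bitsK w).
have bij : bijective (@of_bits w).
  by apply: inj_card_bij inj _; rewrite card_ord card_tuple card_bool.
by move=> j; have [g _ gK] := bij; rewrite -(gK j) of_bitsK.
Qed.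

Definition zeros k : k.-tuple bool := nseq_tuple k false.

Definition ket (R : realType) w (x : w.-tuple bool) : 'cV[R[i]]_(2 ^ w) :=
  delta_mx (of_bits x) 0.

(* |0^m> (x) I_n : the m ancilla wires come first. *)
Definition ket0_tens_id (R : realType) m n : 'M[R[i]]_(2 ^ (m + n), 2 ^ n) :=
  \matrix_(r, j) ket R [tuple of zeros m ++ to_bits j] r 0.

(* I_n (x) |0^v> *)
Definition id_tens_ket0 (R : realType) n v : 'M[R[i]]_(2 ^ (n + v), 2 ^ n) :=
  \matrix_(r, j) ket R [tuple of to_bits j ++ zeros v] r 0.

Definition l2norm (R : realType) p (x : 'cV[R[i]]_p) : R :=
  Num.sqrt (\sum_j normc (x j 0) ^+ 2).

(* The set is nonempty and bounded, so sup is the actual supremum. *)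
Definition opnorm (R : realType) p q (M : 'M[R[i]]_(p, q)) : R :=
  sup [set y : R | exists2 x : 'cV[R[i]]_q, l2norm x <= 1 & y = l2norm (M *m x)]%classic.

Definition block_encoding (R : realType) n (alpha : R) (m : nat) (eps : R)
    (M : 'M[R[i]]_(2 ^ n)) (U : 'M[R[i]]_(2 ^ (m + n))) : Prop :=
  U \is unitarymx /\
  opnorm (M - alpha%:C *: ((ket0_tens_id R m n)^t* *m U *m ket0_tens_id R m n))
    <= eps.

Arguments block_encoding {R n} alpha m eps M U.

(* The k-qubit operator G acting on the wires f(0), ..., f(k-1) of a w-qubit
   register, and as the identity on the other wires. *)
Definition on_wires (R : realType) w k (f : k.-tuple 'I_w)
    (G : 'M[R[i]]_(2 ^ k)) : 'M[R[i]]_(2 ^ w) :=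
  \matrix_(r, c)
    if [forall q : 'I_w, (q \in f) || (tnth (to_bits r) q == tnth (to_bits c) q)]
    then G (of_bits (map_tuple (tnth (to_bits r)) f))
           (of_bits (map_tuple (tnth (to_bits c)) f))
    else 0.

Record gate (R : realType) (w : nat) := MkGate {
  gate_arity : nat;
  gate_wires : gate_arity.-tuple 'I_w;
  gate_mx : 'M[R[i]]_(2 ^ gate_arity);
  _ : uniq gate_wires;
  _ : gate_mx \is unitarymx }.

(* Circuits are lists in order of application: the head acts first. *)
Definition run (R : realType) w (s : seq 'M[R[i]]_(2 ^ w)) : 'M[R[i]]_(2 ^ w) :=
  foldl (fun acc G => G *m acc) 1%:M s.

Definition run_gates (R : realType) w (s : seq (gate R w)) : 'M[R[i]]_(2 ^ w) :=
  run [seq on_wires (gate_wires g) (gate_mx g) | g <- s].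

(* An oracle circuit on w wires is a circuit with named slots.  O stands for
   the eigenvalue oracle, acting on n + l qubits and a work qubits; V for the
   circuit of the eigenbasis change, acting on n qubits and v work qubits.
   The flag dag selects the adjoint.  Gates other than queries are fixed
   unitaries, which cannot depend on what is plugged into the slots. *)
Inductive oinstr (R : realType) (n l a v w : nat) :=
| Gate of gate R w
| QueryO (dag : bool) (f : (n + (l + a)).-tuple 'I_w) of uniq f
| QueryV (dag : bool) (f : (n + v).-tuple 'I_w) of uniq f.

Definition ocircuit (R : realType) n l a v w := seq (oinstr R n l a v w).

Definition oinstr_mx (R : realType) n l a v w
    (O : 'M[R[i]]_(2 ^ (n + (l + a)))) (W : 'M[R[i]]_(2 ^ (n + v)))
    (g : oinstr R n l a v w) : 'M[R[i]]_(2 ^ w) :=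
  match g with
  | Gate h => on_wires (gate_wires h) (gate_mx h)
  | QueryO dag f _ => on_wires f (if dag then O^t* else O)
  | QueryV dag f _ => on_wires f (if dag then W^t* else W)
  end.

Definition run_ocircuit (R : realType) n l a v w
    (O : 'M[R[i]]_(2 ^ (n + (l + a)))) (W : 'M[R[i]]_(2 ^ (n + v)))
    (c : ocircuit R n l a v w) : 'M[R[i]]_(2 ^ w) :=
  run [seq oinstr_mx O W g | g <- c].

Definition is_queryO (R : realType) n l a v w (dag : bool)
    (g : oinstr R n l a v w) : bool :=
  if g is QueryO dag' _ _ then dag' == dag else false.

Definition is_queryV (R : realType) n l a v w (dag : bool)
    (g : oinstr R n l a v w) : bool :=
  if g is QueryV dag' _ _ then dag' == dag else false.

Definition queries_once (R : realType) n l a v w (c : ocircuit R n l a v w) : Prop :=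
  [/\ count (is_queryO false) c = 1%N, count (is_queryO true) c = 1%N,
      count (is_queryV false) c = 1%N & count (is_queryV true) c = 1%N].

(* O |j>|0^l>|0^a> = |j>|code j>|0^a> *)
Definition eigenvalue_oracle (R : realType) n l a
    (code : 'I_(2 ^ n) -> l.-tuple bool) (O : 'M[R[i]]_(2 ^ (n + (l + a)))) : Prop :=
  O \is unitarymx /\
  forall j : 'I_(2 ^ n),
    O *m ket R [tuple of to_bits j ++ [tuple of zeros l ++ zeros a]]
    = ket R [tuple of to_bits j ++ [tuple of code j ++ zeros a]].

(* The v work qubits start in and are returned to |0^v>. *)
Definition implements (R : realType) n v (s : seq (gate R (n + v)))
    (V : 'M[R[i]]_(2 ^ n)) : Prop :=
  run_gates s *m id_tens_ket0 R n v = id_tens_ket0 R n v *m V.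

Definition min_norm (R : realType) n (d : 'rV[R[i]]_(2 ^ n)) : R :=
  \big[Num.min/normc (d 0 (of_bits (zeros n)))]_(j < 2 ^ n) normc (d 0 j).

Definition polylog (p : nat -> nat) : Prop :=
  exists c k N0 : nat,
    forall N, (N0 <= N)%N -> (p N <= c * trunc_log 2 N ^ k)%N.

(* f = O(l + polylog N) along a family of instances with N = 2 ^ n. *)
Definition bigO_l_polylog (I : Type) (n l f : I -> nat) : Prop :=
  exists2 p, polylog p &
    exists c : nat, forall t, (f t <= c * (l t + p (2 ^ n t)))%N.

(* Efficiency only makes sense for a family: polylog(N) one- and two-qubit
   gates, and polylog(N) work qubits. *)
Definition efficient (R : realType) (I : Type) (n v : I -> nat)
    (s : forall t, seq (gate R (n t + v t))) : Prop :=
  (forall t, all (fun g => gate_arity g <= 2)%N (s t)) /\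
  exists2 p, polylog p &
    forall t, (v t <= p (2 ^ n t))%N /\ (size (s t) <= p (2 ^ n t))%N.

(* Main.v *)
Require Import Defs.
From mathcomp Require Import all_boot all_order all_algebra.
From mathcomp Require Import spectral.
From mathcomp Require Import classical_sets reals.
From mathcomp Require Import complex.
From mathcomp Require Import zify.

Set Implicit Arguments.
Unset Strict Implicit.
Unset Printing Implicit Defensive.

Import Order.TTheory GRing.Theory Num.Theory.
Local Open Scope ring_scope.
Local Open Scope sesquilinear_scope.

(* The circuit is U = P^* R P, where P applies V^* to the system and then loads
   the eigenvalue with O_D, and R rotates a flag qubit controlled by the value
   register. P sends |0>|j> to the combination with the coefficients of
   V^* |j> of the states |0>|code k>|0>|k>. In these states the flag |0> is kept
   with amplitude 1 / (alpha d_k) and the system register is not touched by R,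
   so the encoded block of U is V diag(1 / (alpha d_k)) V^* = A^-1 / alpha. *)

(** * Bit strings compared and modified on selected wires *)

Section Wires.
Variables (w k : nat) (f : k.-tuple 'I_w).
Implicit Types (x y z : w.-tuple bool) (u : k.-tuple bool).

Definition read_wires x : k.-tuple bool := map_tuple (tnth x) f.

Definition agree_off x y := [forall q, (q \in f) || (tnth x q == tnth y q)].

Definition overwrite u x : w.-tuple bool :=
  [tuple if q \in f then nth false u (index q f) else tnth x q | q < w].

Lemma agree_offP x y :
  reflect (forall q, q \notin f -> tnth x q = tnth y q) (agree_off x y).
Proof.
apply: (iffP forallP) => xy q; first by move=> /negPf fq; have := xy q; rewrite fq => /eqP.
by case: (boolP (q \in f)) => //= /xy ->.
Qed.

Lemma agree_offxx x : agree_off x x.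
Proof. exact/agree_offP. Qed.

Lemma agree_off_sym : symmetric agree_off.
Proof. by move=> x y; apply: eq_forallb => q; rewrite eq_sym. Qed.

Lemma agree_off_trans : transitive agree_off.
Proof.
move=> y x z /agree_offP xy /agree_offP yz.
by apply/agree_offP => q fq; rewrite xy // yz.
Qed.

Lemma eq_read_wires x y : agree_off x y ->
  (read_wires x == read_wires y) = (x == y).
Proof.
move=> /agree_offP xy; apply/eqP/eqP => [exy|->//]; apply: eq_from_tnth => q.
have [/tnthP[j ->]|/xy //] := boolP (q \in f).
by have := congr1 (fun u => tnth u j) exy; rewrite !tnth_map.
Qed.

Lemma agree_off_overwrite u x : agree_off (overwrite u x) x.
Proof. by apply/agree_offP => q /negPf fq; rewrite tnth_mktuple fq. Qed.

Lemma read_overwrite u x : uniq f -> read_wires (overwrite u x) = u.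
Proof.
move=> uf; apply: eq_from_tnth => j.
rewrite tnth_map tnth_mktuple mem_tnth (tnth_nth (tnth f j)) index_uniq ?size_tuple //.
by rewrite -tnth_nth.
Qed.

Lemma overwrite_read x y : agree_off x y -> overwrite (read_wires x) y = x.
Proof.
move=> /agree_offP xy; apply: eq_from_tnth => q; rewrite tnth_mktuple.
case: ifPn => [fq|/xy //].
by rewrite (nth_map q) ?index_mem // nth_index.
Qed.

(** Overwriting the wires of [f] and reading them back are inverse bijections between [k]-bit
    strings and the class of [x] under [agree_off f]. Distinct wires are essential: a repeated wire
    could not hold two different bits of [u]. *)
Lemma sum_agree_off (V : nmodType) x (F : w.-tuple bool -> V) : uniq f ->
  \sum_(z | agree_off z x) F z = \sum_u F (overwrite u x).
Proof.
move=> uf; rewrite (reindex_onto (overwrite^~ x) read_wires) => [|z]; last exact: overwrite_read.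
by apply: eq_bigl => u; rewrite agree_off_overwrite read_overwrite ?eqxx.
Qed.

End Wires.

Lemma of_bits_bij w : bijective (@of_bits w).
Proof. exact: Bijective (@of_bitsK w) (@to_bitsK w). Qed.

Lemma eq_of_bits w (x y : w.-tuple bool) : (of_bits x == of_bits y) = (x == y).
Proof. exact/inj_eq/bij_inj/of_bits_bij. Qed.

Lemma sum_of_bits w (V : nmodType) (F : 'I_(2 ^ w) -> V) :
  \sum_j F j = \sum_(x : w.-tuple bool) F (of_bits x).
Proof. exact/reindex/onW_bij/of_bits_bij. Qed.

(** * Embedding operators on selected wires preserves products, adjoints and unitarity *)

Section OnWires.
Variables (R : realType) (w k : nat) (f : k.-tuple 'I_w).
Implicit Types (G H : 'M[R[i]]_(2 ^ k)) (x y z : w.-tuple bool).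

Lemma on_wiresE G x y : on_wires f G (of_bits x) (of_bits y) =
  if agree_off f x y then G (of_bits (read_wires f x)) (of_bits (read_wires f y)) else 0.
Proof. by rewrite mxE !of_bitsK. Qed.

Lemma eq_matrix_of_bits p (A B : 'M[R[i]]_(2 ^ w, p)) :
  (forall x j, A (of_bits x) j = B (of_bits x) j) -> A = B.
Proof.
by move=> AB; apply/matrixP => r j; rewrite -(to_bitsK r) AB.
Qed.

Lemma on_wires_tr G : on_wires f (G^t*) = (on_wires f G)^t*.
Proof.
apply: eq_matrix_of_bits => x j; rewrite -(to_bitsK j) on_wiresE !mxE !of_bitsK.
by rewrite -/(agree_off _ _ _) agree_off_sym; case: ifP; rewrite ?rmorph0.
Qed.

Lemma on_wires1 : on_wires f 1%:M = 1%:M :> 'M[R[i]]_(2 ^ w).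
Proof.
apply: eq_matrix_of_bits => x j; rewrite -(to_bitsK j) on_wiresE !mxE !eq_of_bits.
case: ifPn => [xy|]; first by rewrite eq_read_wires.
by case: eqP => [->|//]; rewrite agree_offxx.
Qed.

Hypothesis uf : uniq f.

(** An intermediate string contributes only if it agrees with both end strings off [f]. Such strings
    are indexed by their contents on [f], so the sum over [w]-bit strings becomes the [k]-bit sum of
    the small product. *)
Lemma on_wiresM G H : on_wires f (G *m H) = on_wires f G *m on_wires f H.
Proof.
apply: eq_matrix_of_bits => x j; rewrite -(to_bitsK j); move: (to_bits j) => y.
rewrite on_wiresE !mxE [RHS]sum_of_bits; case: ifPn => [xy|nxy].
  rewrite sum_of_bits [RHS](bigID (agree_off f ^~ y)) /= [X in _ + X]big1 => [|z zy]; last first.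
    by rewrite [X in _ * X]on_wiresE (negPf zy) mulr0.
  rewrite addr0 sum_agree_off //; apply: eq_bigr => u _.
  have ouy := agree_off_overwrite f u y.
  rewrite !on_wiresE ouy read_overwrite // (agree_off_trans xy) //.
  by rewrite agree_off_sym.
(* By transitivity, no intermediate string agrees with both [x] and [y] off [f]. *)
rewrite big1 // => z _; rewrite !on_wiresE; case: ifP => [xz|]; last by rewrite mul0r.
case: ifP => [zy|]; last by rewrite mulr0.
by rewrite (agree_off_trans xz zy) in nxy.
Qed.

Lemma on_wires_unitary G : G \is unitarymx -> on_wires f G \is unitarymx.
Proof.
by move=> /unitarymxP GG; apply/unitarymxP; rewrite -on_wires_tr -on_wiresM GG on_wires1.
Qed.

End OnWires.

Lemma run_gates_unitary (R : realType) w (s : seq (gate R w)) :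
  run_gates s \is unitarymx.
Proof.
rewrite /run_gates /run.
suff foldU (U : 'M[R[i]]_(2 ^ w)) : U \is unitarymx ->
    foldl (fun acc G => G *m acc) U [seq on_wires (gate_wires g) (gate_mx g) | g <- s]
      \is unitarymx.
  by apply: foldU; apply/unitarymxP; rewrite trmx1 map_mx1 mulmx1.
elim: s U => [//|[k f G uf uG] s IHs] U uU.
by apply: IHs; apply: mul_unitarymx uU; apply: on_wires_unitary.
Qed.

(** * Matrices whose columns are basis states *)

Definition kets (R : realType) p w (z : 'I_p -> w.-tuple bool) : 'M[R[i]]_(2 ^ w, p) :=
  \matrix_(r, j) ket R (z j) r 0.

Section Kets.
Variables (R : realType) (p w : nat).
Implicit Type z : 'I_p -> w.-tuple bool.

Lemma ketsE z x j : kets R z (of_bits x) j = (x == z j)%:R.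
Proof. by rewrite !mxE eqxx andbT eq_of_bits. Qed.

Lemma eq_kets z z' :
  z =1 z' -> kets R z = kets R z'.
Proof. by move=> zz'; apply/matrixP => r j; rewrite 2![in LHS]mxE 2![in RHS]mxE zz'. Qed.

(** Multiplying by [kets] selects columns, and multiplying by its adjoint on the left selects rows.
    Both [ket0_tens_id] and [id_tens_ket0] are instances of [kets], so compressions of a circuit
    become submatrices. *)
Lemma mulmx_kets q (M : 'M[R[i]]_(q, 2 ^ w)) z r j : (M *m kets R z) r j = M r (of_bits (z j)).
Proof.
rewrite mxE (bigD1 (of_bits (z j))) //= ketsE eqxx mulr1 big1 ?addr0 // => s.
by rewrite -(to_bitsK s) ketsE eq_of_bits => /negPf ->; rewrite mulr0.
Qed.

Lemma kets_tr_mulmx q (M : 'M[R[i]]_(2 ^ w, q)) z i j :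
  ((kets R z)^t* *m M) i j = M (of_bits (z i)) j.
Proof.
rewrite mxE (bigD1 (of_bits (z i))) //= 2!mxE ketsE eqxx rmorph1 mul1r big1 ?addr0 // => s.
by rewrite -(to_bitsK s) 2!mxE ketsE eq_of_bits => /negPf ->; rewrite rmorph0 mul0r.
Qed.

End Kets.

(** Lifts an intertwining relation from the wires of [f] to the whole register. Since all strings
    involved coincide off [f], they are determined by what is read on [f]. *)
Lemma on_wires_kets (R : realType) p w k (z z' : 'I_p -> w.-tuple bool)
    (f : k.-tuple 'I_w) (G : 'M[R[i]]_(2 ^ k)) (M : 'M_p) :
    (forall i j, agree_off f (z' i) (z j)) ->
    G *m kets R (read_wires f \o z) = kets R (read_wires f \o z') *m M ->
  on_wires f G *m kets R z = kets R z' *m M.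
Proof.
move=> z'z GM; apply: eq_matrix_of_bits => x j; rewrite mulmx_kets on_wiresE.
have -> : G (of_bits (read_wires f x)) (of_bits (read_wires f (z j))) =
          (G *m kets R (read_wires f \o z)) (of_bits (read_wires f x)) j.
  by rewrite mulmx_kets.
rewrite GM !mxE; case: ifPn => [xz|nxz].
  apply: eq_bigr => i _; rewrite !ketsE /= eq_read_wires //.
  by apply: agree_off_trans xz _; rewrite agree_off_sym.
(* A string [x] that differs from [z j] off [f] is none of the [z' i], so the right-hand side
   vanishes too. *)
rewrite big1 // => i _; rewrite ketsE; case: eqP => [xz'|]; last by rewrite mul0r.
by rewrite xz' z'z in nxz.
Qed.

(** * The controlled rotation *)

Definition rot_coef (C : numClosedFieldType) (c : C) (b b' : bool) : C :=
  if b then if b' then c^* else sqrtC (1 - `|c| ^+ 2)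
  else if b' then - sqrtC (1 - `|c| ^+ 2) else c.

(** The column [b' = false] is the prescribed image of the flag |0>; the other column completes it
    to a unitary, with [c^*] because eigenvalues may be complex. The bound on [c] makes the square
    root real, hence self-conjugate. *)
Lemma rot_coef_orthonormal (C : numClosedFieldType) (c : C) b1 b2 : `|c| <= 1 ->
  \sum_b rot_coef c b1 b * (rot_coef c b2 b)^* = (b1 == b2)%:R.
Proof.
move=> c1; rewrite big_bool /=.
have ge0s : 0 <= 1 - `|c| ^+ 2 by rewrite subr_ge0 expr_le1.
set s := sqrtC (1 - `|c| ^+ 2); have ss : s^* = s by rewrite geC0_conj // sqrtC_ge0.
have s2 : s * s = 1 - `|c| ^+ 2 by rewrite -expr2 sqrtCK.
have cc : c^* * c = `|c| ^+ 2 by rewrite normCK mulrC.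
case: b1; case: b2; rewrite /rot_coef -/s ?rmorphN ?conjCK /= ?ss ?mulrNN ?s2 ?cc //=.
- by rewrite addrC subrK.
- by rewrite mulrN mulrC addNr.
- by rewrite mulNr mulrC addNr.
- by rewrite mulrC cc subrK.
Qed.

Lemma trmxCE (C : numClosedFieldType) m n (M : 'M[C]_(m, n)) r s :
  (M^t*) r s = (M s r)^*.
Proof. by rewrite !mxE. Qed.

Section Rotation.
Variables (R : realType) (l : nat) (c : l.-tuple bool -> R[i]).
Implicit Types (b : bool) (u : l.-tuple bool) (x : (1 + l).-tuple bool).

Definition cat_bit b u : (1 + l).-tuple bool := [tuple of [tuple b] ++ u].
Definition first_bit x : bool := tnth x (lshift l ord0).
Definition other_bits x : l.-tuple bool := [tuple tnth x (rshift 1 q) | q < l].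

Lemma first_bit_cat b u : first_bit (cat_bit b u) = b.
Proof. by rewrite /first_bit tnth_lshift. Qed.

Lemma other_bits_cat b u : other_bits (cat_bit b u) = u.
Proof. by apply: eq_from_tnth => q; rewrite tnth_mktuple tnth_rshift. Qed.

Lemma cat_first_other x : cat_bit (first_bit x) (other_bits x) = x.
Proof.
apply: eq_from_tnth => q; case: (split_ordP q) => j ->.
  by rewrite tnth_lshift !ord1.
by rewrite tnth_rshift tnth_mktuple.
Qed.

Lemma eq_cat_bit b b' u u' : (cat_bit b u == cat_bit b' u') = (u == u') && (b == b').
Proof.
apply/eqP/andP => [e|[/eqP -> /eqP -> //]].
split; apply/eqP.
  by rewrite -(other_bits_cat b u) e other_bits_cat.
by rewrite -(first_bit_cat b u) e first_bit_cat.
Qed.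

Lemma sum_cat_bit (V : nmodType) (F : (1 + l).-tuple bool -> V) :
  \sum_x F x = \sum_u \sum_b F (cat_bit b u).
Proof.
rewrite pair_big /= (reindex (fun p => cat_bit p.2 p.1)) //.
exists (fun x => (other_bits x, first_bit x)) => [[u b] _|x _] /=.
  by rewrite other_bits_cat first_bit_cat.
exact: cat_first_other.
Qed.

(* Qubit 0 is the target of the rotation, the other l qubits control it. *)
Definition rot_mx : 'M[R[i]]_(2 ^ (1 + l)) :=
  \matrix_(r, s)
    let x := to_bits r in let y := to_bits s in
    if other_bits x == other_bits y
    then rot_coef (c (other_bits x)) (first_bit x) (first_bit y) else 0.

Lemma rot_mxE b b' u u' :
  rot_mx (of_bits (cat_bit b u)) (of_bits (cat_bit b' u')) =
  if u == u' then rot_coef (c u) b b' else 0.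
Proof. by rewrite mxE !of_bitsK /= !other_bits_cat !first_bit_cat. Qed.

(** The matrix is block diagonal along the control strings, with one 2 by 2 unitary block for each
    string. *)
Lemma rot_mx_unitary : (forall u, `|c u| <= 1) -> rot_mx \is unitarymx.
Proof.
move=> c1; apply/unitarymxP; apply: eq_matrix_of_bits => x j; rewrite -(to_bitsK j).
rewrite -(cat_first_other x) -(cat_first_other (to_bits j)).
move: (first_bit x) (other_bits x) (first_bit (to_bits j)) (other_bits (to_bits j)) => b1 u1 b2 u2.
rewrite [LHS]mxE [RHS]mxE sum_of_bits sum_cat_bit (bigD1 u2) //= [X in _ + X]big1 ?addr0.
  under eq_bigr => b _ do rewrite trmxCE !rot_mxE eqxx.
  rewrite eq_of_bits eq_cat_bit.
  case: eqP => [->|_]; first by rewrite ?eqxx; exact: rot_coef_orthonormal (c1 _).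
  by rewrite big1 // => b _; rewrite mul0r.
move=> u /negPf uu2; rewrite big1 // => b _.
by rewrite trmxCE !rot_mxE [u2 == u]eq_sym uu2 rmorph0 mulr0.
Qed.

End Rotation.

(** * Layout of the register and wires of the subcircuits *)

Lemma read_wires_cat w k1 k2 (f1 : k1.-tuple 'I_w) (f2 : k2.-tuple 'I_w) x :
  read_wires [tuple of f1 ++ f2] x = [tuple of read_wires f1 x ++ read_wires f2 x].
Proof. by apply/val_inj; rewrite /= map_cat. Qed.

Lemma zerosD k1 k2 : zeros (k1 + k2) = [tuple of zeros k1 ++ zeros k2].
Proof. by apply/val_inj; rewrite /= nseqD. Qed.

Section Circuit.
Variables (R : realType) (n l a v : nat).

(** The flag qubit, the value register, and separate work registers for the oracle and for the
    eigenbasis circuit. *)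
Definition ancillas := (1 + (l + (a + v)))%N.

Definition layout b (x : l.-tuple bool) (y : a.-tuple bool) (z : v.-tuple bool)
    (s : n.-tuple bool) : (ancillas + n).-tuple bool :=
  [tuple of [tuple of [tuple b] ++ [tuple of x ++ [tuple of y ++ z]]] ++ s].

Definition flag_wire (q : 'I_1) : 'I_(ancillas + n) := lshift n (lshift _ q).
Definition value_wire (q : 'I_l) : 'I_(ancillas + n) := lshift n (rshift 1 (lshift _ q)).
Definition owork_wire (q : 'I_a) : 'I_(ancillas + n) :=
  lshift n (rshift 1 (rshift l (lshift v q))).
Definition vwork_wire (q : 'I_v) : 'I_(ancillas + n) :=
  lshift n (rshift 1 (rshift l (rshift a q))).
Definition sys_wire (q : 'I_n) : 'I_(ancillas + n) := rshift _ q.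

Definition rot_wires : (1 + l).-tuple 'I_(ancillas + n) :=
  [tuple of mktuple flag_wire ++ mktuple value_wire].
Definition oracle_wires : (n + (l + a)).-tuple 'I_(ancillas + n) :=
  [tuple of mktuple sys_wire ++ [tuple of mktuple value_wire ++ mktuple owork_wire]].
Definition basis_wires : (n + v).-tuple 'I_(ancillas + n) :=
  [tuple of mktuple sys_wire ++ mktuple vwork_wire].

Lemma wire_cases (P : 'I_(ancillas + n) -> Prop) :
  (forall q, P (flag_wire q)) -> (forall q, P (value_wire q)) ->
  (forall q, P (owork_wire q)) -> (forall q, P (vwork_wire q)) ->
  (forall q, P (sys_wire q)) -> forall q, P q.
Proof.
move=> Pf Pl Pa Pv Ps q; case: (split_ordP q) => {}q ->; last exact: Ps.
case: (split_ordP q) => {}q ->; first exact: Pf.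
case: (split_ordP q) => {}q ->; first exact: Pl.
by case: (split_ordP q) => {}q ->; [exact: Pa | exact: Pv].
Qed.

Lemma uniq_mktuple (T : eqType) k (f : 'I_k -> T) : injective f -> uniq (mktuple f).
Proof. by move=> f_inj; rewrite map_inj_uniq ?enum_uniq. Qed.

Lemma disjoint_mktuple (T : eqType) k1 k2 (f : 'I_k1 -> T) (g : 'I_k2 -> T) :
  (forall i j, f i != g j) -> ~~ has (mem (mktuple f)) (mktuple g).
Proof.
move=> fg; apply/hasPn => _ /mapP[j _ ->]; apply/negP => /mapP[i _ /eqP].
by rewrite eq_sym (negPf (fg i j)).
Qed.

Lemma rot_wires_uniq : uniq rot_wires.
Proof.
rewrite cat_uniq !uniq_mktuple ?disjoint_mktuple // => [i j|i j /(congr1 val)|i j /(congr1 val)] /=.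
- by rewrite -val_eqE /=; have := ltn_ord i; lia.
- by rewrite /= => ?; apply/val_inj => /=; lia.
- by rewrite /= => ?; apply/val_inj => /=; lia.
Qed.

Lemma oracle_wires_uniq : uniq oracle_wires.
Proof.
rewrite cat_uniq [X in [&& _, _ & X]]cat_uniq has_cat !uniq_mktuple ?negb_or ?disjoint_mktuple //
  => [i j|i j|i j|i j /(congr1 val)|i j /(congr1 val)|i j /(congr1 val)] /=;
  try by rewrite -val_eqE /=; have := ltn_ord i; have := ltn_ord j; rewrite /ancillas; lia.
all: by rewrite /= => ?; apply/val_inj => /=; lia.
Qed.

Lemma basis_wires_uniq : uniq basis_wires.
Proof.
rewrite cat_uniq !uniq_mktuple ?disjoint_mktuple // => [i j|i j /(congr1 val)|i j /(congr1 val)] /=.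
- by rewrite -val_eqE /=; have := ltn_ord i; have := ltn_ord j; rewrite /ancillas; lia.
- by rewrite /= => ?; apply/val_inj => /=; lia.
- by rewrite /= => ?; apply/val_inj => /=; lia.
Qed.

Lemma layout_wires b x y z s :
  [/\ read_wires (mktuple flag_wire) (layout b x y z s) = [tuple b],
      read_wires (mktuple value_wire) (layout b x y z s) = x,
      read_wires (mktuple owork_wire) (layout b x y z s) = y,
      read_wires (mktuple vwork_wire) (layout b x y z s) = z &
      read_wires (mktuple sys_wire) (layout b x y z s) = s].
Proof.
by split; apply: eq_from_tnth => q;
  rewrite tnth_map tnth_mktuple ?tnth_rshift // !(tnth_lshift, tnth_rshift).
Qed.

Lemma read_rot b x y z s : read_wires rot_wires (layout b x y z s) = cat_bit b x.
Proof. by rewrite read_wires_cat; case: (layout_wires b x y z s) => -> ->. Qed.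

Lemma read_oracle b x y z s :
  read_wires oracle_wires (layout b x y z s) = [tuple of s ++ [tuple of x ++ y]].
Proof. by rewrite !read_wires_cat; case: (layout_wires b x y z s) => _ -> -> _ ->. Qed.

Lemma read_basis b x y z s :
  read_wires basis_wires (layout b x y z s) = [tuple of s ++ z].
Proof. by rewrite read_wires_cat; case: (layout_wires b x y z s) => _ _ _ -> ->. Qed.

Lemma mem_mktuple (T : eqType) k (f : 'I_k -> T) i : f i \in mktuple f.
Proof. by rewrite map_f ?mem_enum. Qed.

Lemma agree_off_oracle b z x x' y y' s s' :
  agree_off oracle_wires (layout b x y z s) (layout b x' y' z s').
Proof.
apply/agree_offP; apply: wire_cases => q; rewrite ?mem_cat ?mem_mktuple ?orbT //= => _;
  by rewrite !(tnth_lshift, tnth_rshift).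
Qed.

Lemma agree_off_basis b x y z z' s s' :
  agree_off basis_wires (layout b x y z s) (layout b x y z' s').
Proof.
apply/agree_offP; apply: wire_cases => q; rewrite ?mem_cat ?mem_mktuple ?orbT //= => _;
  by rewrite !(tnth_lshift, tnth_rshift).
Qed.

(** The system wires are not among the rotation wires. This makes the rotation diagonal in the
    eigenvalue index even when several eigenvalues coincide and share a code. *)
Lemma agree_off_rot b b' x x' y y' z z' s s' :
  agree_off rot_wires (layout b x y z s) (layout b' x' y' z' s') -> s = s'.
Proof.
move=> /agree_offP agr; apply: eq_from_tnth => q; have := agr (sys_wire q).
rewrite !tnth_rshift; apply; rewrite mem_cat negb_or.
apply/andP; split; apply/negP => /mapP[i _ /(congr1 val)] /=;
  have := ltn_ord i; rewrite /ancillas; lia.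
Qed.

Lemma layout_zeros (s : n.-tuple bool) :
  [tuple of zeros ancillas ++ s] = layout false (zeros l) (zeros a) (zeros v) s.
Proof. by rewrite /ancillas !zerosD; apply/val_inj. Qed.

End Circuit.

(** * The inversion circuit and its encoded block *)

Import ComplexField.Normc.
Local Open Scope complex_scope.

(** Applied with [K] the initial states, [E] the states with loaded eigenvalues and [Q] the adjoint
    of [V]: it reduces the encoded block to the compression of the rotation to the loaded states. *)
Lemma conj_intertwine (C : numClosedFieldType) m1 m2 m3 (P M : 'M[C]_m1) (K : 'M_(m1, m2))
    (E : 'M_(m1, m3)) (Q : 'M_(m3, m2)) : P *m K = E *m Q ->
  K^t* *m (P^t* *m M *m P) *m K = Q^t* *m (E^t* *m M *m E) *m Q.
Proof.
move=> PK; rewrite -!mulmxA PK !mulmxA -!map_mxM -!trmx_mul PK.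
by rewrite trmx_mul map_mxM.
Qed.

Section Inversion.
Variables (R : realType) (n l a v : nat) (num : l.-tuple bool -> R[i]) (alpha : R).

(* The strings that encode no eigenvalue need a coefficient of modulus at most
   1 as well, for the rotation to be unitary; 0 is an arbitrary choice. *)
Definition inv_coef u : R[i] :=
  let c := (alpha%:C * num u)^-1 in if `|c| <= 1 then c else 0.

Lemma norm_inv_coef u : `|inv_coef u| <= 1.
Proof. by rewrite /inv_coef; case: ifP => // _; rewrite normr0 ler01. Qed.

Definition rot_gate : gate R (ancillas l a v + n) :=
  MkGate (rot_wires_uniq n l a v) (rot_mx_unitary norm_inv_coef).

(** The only gate depends on [num] and [alpha] alone, so the circuit is fixed before the matrix and
    the oracle are chosen. *)
Definition inversion_circuit : ocircuit R n l a v (ancillas l a v + n) :=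
  [:: QueryV R l a true (basis_wires_uniq n l a v);
      QueryO R v false (oracle_wires_uniq n l a v);
      Gate n l a v rot_gate;
      QueryO R v true (oracle_wires_uniq n l a v);
      QueryV R l a false (basis_wires_uniq n l a v)].

Lemma queries_once_inversion : queries_once inversion_circuit.
Proof. by []. Qed.

Section Correctness.
Variables (V : 'M[R[i]]_(2 ^ n)) (W : 'M[R[i]]_(2 ^ (n + v))).
Variables (code : 'I_(2 ^ n) -> l.-tuple bool) (O : 'M[R[i]]_(2 ^ (n + (l + a)))).
Hypotheses (uV : V \is unitarymx) (uW : W \is unitarymx).
Hypothesis WV : W *m id_tens_ket0 R n v = id_tens_ket0 R n v *m V.
Hypothesis eO : eigenvalue_oracle code O.

Let half := on_wires (oracle_wires n l a v) O *m on_wires (basis_wires n l a v) (W^t*).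
Let rot := on_wires (rot_wires n l a v) (rot_mx inv_coef).

Lemma run_inversion : run_ocircuit O W inversion_circuit = half^t* *m rot *m half.
Proof.
rewrite /run_ocircuit /run /= mulmx1 /half trmx_mul map_mxM -!on_wires_tr trmxCK.
by rewrite !mulmxA.
Qed.

Lemma run_inversion_unitary : run_ocircuit O W inversion_circuit \is unitarymx.
Proof.
have [uO _] := eO.
have uW' : W^t* \is unitarymx by rewrite trmxC_unitary.
have uh : half \is unitarymx := mul_unitarymx
  (on_wires_unitary (oracle_wires_uniq n l a v) uO)
  (on_wires_unitary (basis_wires_uniq n l a v) uW').
have ur : rot \is unitarymx :=
  on_wires_unitary (rot_wires_uniq n l a v) (rot_mx_unitary norm_inv_coef).
have uh' : half^t* \is unitarymx := etrans (trmxC_unitary half) uh.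
by rewrite run_inversion; exact: mul_unitarymx (mul_unitarymx uh' ur) uh.
Qed.

Let start (j : 'I_(2 ^ n)) := layout false (zeros l) (zeros a) (zeros v) (to_bits j).
Let loaded (j : 'I_(2 ^ n)) := layout false (code j) (zeros a) (zeros v) (to_bits j).

(** The inverse circuit also returns its work qubits to zero: insert [V *m V^t*] after the
    embedding, trade [V] for [W] and cancel [W] by unitarity. *)
Lemma adjoint_implements : W^t* *m id_tens_ket0 R n v = id_tens_ket0 R n v *m V^t*.
Proof.
have WW : W^t* *m W = 1%:M by apply: mulmx1C; apply/unitarymxP.
by rewrite -[in LHS](mulmxtVK (id_tens_ket0 R n v) uV) -WV !mulmxA WW mul1mx.
Qed.

Lemma half_start : half *m kets R start = kets R loaded *m V^t*.
Proof.
rewrite -mulmxA.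
have -> : on_wires (basis_wires n l a v) (W^t*) *m kets R start = kets R start *m V^t*.
  apply: on_wires_kets => [i j|]; first exact: agree_off_basis.
  have -> : kets R (read_wires (basis_wires n l a v) \o start) = id_tens_ket0 R n v.
    by apply: eq_kets => j /=; rewrite read_basis.
  exact: adjoint_implements.
(* The oracle sends each initial state to the loaded state of the same index, so the intertwining
   matrix is the identity. *)
rewrite mulmxA; congr (_ *m _); rewrite -[RHS]mulmx1.
apply: on_wires_kets => [i j|]; first exact: agree_off_oracle.
rewrite mulmx1; apply/matrixP => r j; rewrite mulmx_kets /= read_oracle.
have [_ /(_ j)/matrixP/(_ r 0)] := eO.
(* The oracle is specified on kets; its product with a ket collapses to one column of [O]. *)
rewrite [X in X = _ -> _]mxE
  (bigD1 (of_bits [tuple of to_bits j ++ [tuple of zeros l ++ zeros a]])) //=.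
rewrite !mxE !eqxx mulr1 big1 ?addr0 => [->|s /negPf ns]; last by rewrite mxE ns mulr0.
by rewrite /= read_oracle.
Qed.

(** On the diagonal the flag is |0> on both sides, which picks the entry [c] of the rotation; off
    the diagonal the system strings differ. *)
Lemma rot_loaded :
  (kets R loaded)^t* *m rot *m kets R loaded = diag_mx (\row_j inv_coef (code j)).
Proof.
apply/matrixP => r s; rewrite mulmx_kets kets_tr_mulmx on_wiresE [RHS]mxE [in RHS]mxE.
case: eqP => [->|rs]; first by rewrite agree_offxx read_rot rot_mxE eqxx mulr1n.
case: ifP => // /agree_off_rot/(can_inj (@to_bitsK n))//.
Qed.

Lemma encoded_block :
  (ket0_tens_id R (ancillas l a v) n)^t* *m run_ocircuit O W inversion_circuit
    *m ket0_tens_id R (ancillas l a v) n =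
  V *m diag_mx (\row_j inv_coef (code j)) *m V^t*.
Proof.
have -> : ket0_tens_id R (ancillas l a v) n = kets R start.
  by apply: eq_kets => j; rewrite layout_zeros.
by rewrite run_inversion (conj_intertwine _ half_start) trmxCK rot_loaded.
Qed.

End Correctness.
End Inversion.

(** * Norm bounds and exactness of the block-encoding *)

Lemma min_norm_gt0 (R : realType) n (d : 'rV[R[i]]_(2 ^ n)) :
  (forall j, d 0 j != 0) -> 0 < min_norm d.
Proof.
move=> d0; have nd j : 0 < normc (d 0 j).
  by rewrite -(ltcR 0) -[(normc _)%:C]/(`|d 0 j|) normr_gt0.
by apply/bigmin_gtP.
Qed.

Lemma l2norm0 (R : realType) p : l2norm (0 : 'cV[R[i]]_p) = 0.
Proof. by rewrite /l2norm big1 ?sqrtr0 // => j _; rewrite mxE normc0 expr0n. Qed.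

Lemma opnorm0 (R : realType) p q : opnorm (0 : 'M[R[i]]_(p, q)) <= 0.
Proof.
apply: ge_sup => [|_ [x _ ->]]; last by rewrite mul0mx l2norm0.
(* Bounding [sup] from above requires a nonempty set; the zero vector provides an element. *)
by exists 0; exists 0; rewrite ?mul0mx l2norm0 ?ler01.
Qed.

Lemma block_encoding_inversion (R : realType) n l a v
    (num : l.-tuple bool -> R[i]) (alpha : R) (A V : 'M[R[i]]_(2 ^ n))
    (d : 'rV[R[i]]_(2 ^ n)) code (O : 'M[R[i]]_(2 ^ (n + (l + a))))
    (s : seq (gate R (n + v))) :
    A \in unitmx -> V \is unitarymx -> A = V *m diag_mx d *m V^t* ->
    eigenvalue_oracle code O -> (forall j, num (code j) = d 0 j) ->
    implements s V -> 1 / min_norm d <= alpha ->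
  block_encoding alpha (ancillas l a v) 0 (invmx A)
    (run_ocircuit O (run_gates s) (inversion_circuit n a v num alpha)).
Proof.
move=> uA uV AE eO numE sV alpha_ge.
have d0 j : d 0 j != 0.
  (* The diagonal factor of an invertible product is invertible, and its determinant is the product
     of the eigenvalues. *)
  move: uA; rewrite AE !unitmx_mul => /andP[/andP[_ +] _].
  by rewrite unitmxE det_diag unitfE => /prodf_neq0; apply.
have min0 := min_norm_gt0 d0.
have alpha0 : 0 < alpha by apply: lt_le_trans alpha_ge; rewrite div1r invr_gt0.
have aC0 : alpha%:C != 0 by rewrite gt_eqF // (ltcR 0).
(* The bound on [alpha] gives modulus at least 1 to [alpha * d_j], so codes of eigenvalues never
   fall into the default branch of [inv_coef]. *)
have coefE j : d 0 j * (alpha%:C * inv_coef num alpha (code j)) = 1.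
  have norm_ge1 : 1 <= `|alpha%:C * d 0 j|.
    have -> : `|alpha%:C * d 0 j| = (alpha * normc (d 0 j))%:C.
      by rewrite normrM ger0_norm ?(lecR 0) ?ltW // rmorphM.
    rewrite (lecR 1); apply: le_trans (_ : alpha * min_norm d <= _).
      by rewrite -ler_pdivrMr.
    by rewrite ler_pM2l //; exact: bigmin_le.
  have ad0 : alpha%:C * d 0 j != 0 by rewrite mulf_neq0.
  rewrite /inv_coef numE ifT; last by rewrite normfV invf_le1 // normr_gt0.
  by rewrite mulrA [d 0 j * _]mulrC mulfV.
split; first exact: run_inversion_unitary (run_gates_unitary s) eO.
rewrite (encoded_block _ _ uV (run_gates_unitary s) sV eO) scalemxAl scalemxAr.
(* The scaled block is exactly the inverse, whence error 0; since [A] is invertible, a right inverse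
   suffices. *)
set B := _ *m _ *m _; suff -> : invmx A = B by rewrite subrr opnorm0.
suff AB : A *m B = 1%:M by rewrite -[LHS]mulmx1 -AB mulKmx.
have DD : diag_mx d *m (alpha%:C *: diag_mx (\row_j inv_coef num alpha (code j))) = 1%:M.
  apply/matrixP => i j; rewrite mul_diag_mx !mxE.
  by case: eqP => [->|_]; rewrite ?mulr1n ?coefE // !mulr0n !mulr0.
by rewrite AE /B !mulmxA (mulmxKtV _ uV) // -[V *m _ *m _]mulmxA DD mulmx1 (unitarymxP uV).
Qed.

(** * Counting the ancillas *)

Lemma polylogD1 p q : polylog p -> polylog q -> polylog (fun N => p N + q N + 1)%N.
Proof.
move=> [c1 [k1 [N1 p1]]] [c2 [k2 [N2 p2]]].
(* From [N = 2] on the logarithm is positive, so its power [k1 + k2] dominates both smaller powers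
   and the constant 1. *)
exists (c1 + c2 + 1)%N, (k1 + k2)%N, (maxn 2 (maxn N1 N2)) => N.
rewrite !geq_max => /and3P[N_ge2 /p1 pN /p2 qN].
have log_gt0 : (0 < trunc_log 2 N)%N by rewrite trunc_log_gt0.
rewrite !mulnDl mul1n !leq_add //.
- by apply: leq_trans pN _; rewrite leq_mul2l leq_pexp2l ?orbT ?leq_addr.
- by apply: leq_trans qN _; rewrite leq_mul2l leq_pexp2l ?orbT ?leq_addl.
- by rewrite expn_gt0 log_gt0.
Qed.

Theorem proposition7 (R : realType) (I : Type) (n l a v : I -> nat)
    (num : forall t, (l t).-tuple bool -> R[i]) (alpha : I -> R) :
  exists (m : I -> nat)
         (circ : forall t, ocircuit R (n t) (l t) (a t) (v t) (m t + n t)),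
    (forall t, queries_once (circ t)) /\
    forall (A V : forall t, 'M[R[i]]_(2 ^ n t))
           (d : forall t, 'rV[R[i]]_(2 ^ n t))
           (code : forall t, 'I_(2 ^ n t) -> (l t).-tuple bool)
           (O : forall t, 'M[R[i]]_(2 ^ (n t + (l t + a t))))
           (cV : forall t, seq (gate R (n t + v t))),
      (forall t, A t \in unitmx) ->
      (forall t, A t \is normalmx) ->
      (forall t, V t \is unitarymx) ->
      (forall t, A t = V t *m diag_mx (d t) *m (V t)^t*) ->
      (forall t, eigenvalue_oracle (code t) (O t)) ->
      (forall t j, num t (code t j) = d t 0 j) ->
      (forall t, implements (cV t) (V t)) ->
      efficient cV ->
      (forall t, 1 / min_norm (d t) <= alpha t) ->
      (forall t, block_encoding (alpha t) (m t) 0 (invmx (A t))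
                   (run_ocircuit (O t) (run_gates (cV t)) (circ t))) /\
      (bigO_l_polylog n l a -> bigO_l_polylog n l m).

Proof.
exists (fun t => ancillas (l t) (a t) (v t)),
       (fun t => inversion_circuit (n t) (a t) (v t) (num t) (alpha t)).
split=> [t|A V d code O cV uA _ uV AE eO numE cVV [_ [q q_polylog q_bound]] alpha_ge].
  exact: queries_once_inversion.
split=> [t|[p p_polylog [c a_bound]]].
  exact: block_encoding_inversion (uA t) (uV t) (AE t) (eO t) (numE t) (cVV t) (alpha_ge t).
(* Here [p] comes from the oracle work qubits, [q] bounds those of the eigenbasis circuit, and 1 is
   the flag. *)
exists (fun N => p N + q N + 1)%N; first exact: polylogD1.
(* The factor [c] absorbs the oracle work qubits; one more copy of the bound covers the flag, the
   value register and the other work qubits. *)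
exists c.+1 => t; have := a_bound t; have [v_bound _] := q_bound t.
rewrite /ancillas mulSn mulnDr [in X in _ -> X]mulnDr; nia.
Qed.
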